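(* Let $u\ge0$ be an integer constant, and for each $n$ let $A:\widehat{\mathbb{Z}}^{n+u}\to\widehat{\mathbb{Z}}^n$ be a random $n\times(n+u)$ matrix whose entries are independent and each distributed according to the Haar probability measure on $\widehat{\mathbb{Z}}$. If $u>0$, then \[\lim_{n\to\infty}\mathbb{P}(A\text{ is surjective})=\prod_{k=u+1}^{\infty}\zeta(k)^{-1}.\] If $u=0$, then $\lim_{n\to\infty}\mathbb{P}(A\text{ is surjective})=0$.
   Context: $\widehat{\mathbb{Z}}=\prod_{p\text{ prime}}\mathbb{Z}_p$ is the profinite completion of $\mathbb{Z}$, with its Haar probability measure (the product of the Haar probability measures on the $p$-adic integers $\mathbb{Z}_p$). $\zeta$ is the Riemann zeta function. *)

(* Defs.v *)
From HB Require Import structures.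
From mathcomp Require Import all_boot all_order all_algebra.
From mathcomp Require Import all_classical all_reals all_analysis.
Set Implicit Arguments. Unset Strict Implicit. Unset Printing Implicit Defensive.
Import Order.TTheory GRing.Theory Num.Theory.
Import numFieldNormedType.Exports.
Local Open Scope classical_set_scope.

(* The profinite completion \hat Z of Z, as the inverse limit of the         *)
(* Z/(m+1)Z (m : nat): a compatible family x with x m in [0, m+1) the       *)
(* residue modulo m+1, and x m mod (d+1) = x d whenever (d+1) | (m+1).      *)
Definition zhat_compat (x : nat -> nat) : Prop :=
  (forall m, x m < m.+1) /\
  (forall m d, d.+1 %| m.+1 -> x m %% d.+1 = x d).

Definition Zhat := {x : nat -> nat | zhat_compat x}.

HB.instance Definition _ := gen_eqMixin Zhat.
HB.instance Definition _ := gen_choiceMixin Zhat.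

Definition zres (x : Zhat) (m : nat) : nat := proj1_sig x m.

Lemma zhat_compat_zero : zhat_compat (fun _ => 0).
Proof. by split=> // m d _; rewrite mod0n. Qed.

Definition zzero : Zhat := exist _ (fun _ => 0) zhat_compat_zero.

HB.instance Definition _ := isPointed.Build Zhat zzero.

Lemma zhat_compat_op (op : nat -> nat -> nat) (x y : Zhat) :
  (forall a b k, op a b %% k = op (a %% k) (b %% k) %% k) ->
  zhat_compat (fun m => op (zres x m) (zres y m) %% m.+1).
Proof.
move=> opm; split=> [m|m d dm]; first by rewrite ltn_pmod.
case: x y => [x [bx cx]] [y [by_ cy]]; rewrite /zres /=.
rewrite modn_dvdm // opm (cx _ _ dm) (cy _ _ dm).
by rewrite [RHS]opm.
Qed.

Definition zadd (x y : Zhat) : Zhat :=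
  exist _ _ (zhat_compat_op x y (fun a b k => esym (modnDm a b k))).
Definition zmul (x y : Zhat) : Zhat :=
  exist _ _ (zhat_compat_op x y (fun a b k => esym (modnMm a b k))).

(* Topology/measurability: \hat Z carries the profinite (inverse limit)     *)
(* topology, whose open sets are generated by the (countably many, clopen)  *)
(* cylinders {x | x mod (m+1) = a}; its Borel sigma-algebra is therefore    *)
(* the sigma-algebra generated by these cylinders.                          *)
Definition zhat_cylinders : set (set Zhat) :=
  [set C | exists m a, C = [set x | zres x m = a]].

Definition ZhatM := g_sigma_algebraType zhat_cylinders.

Definition ztranslate (t : Zhat) (B : set ZhatM) : set ZhatM :=
  (fun x : ZhatM => zadd t x) @` B.

Section RandomMatrix.
Context {R : realType} {d : measure_display} {Omega : measurableType d}.
Variable P : probability Omega R.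

Definition haar_distributed (X : Omega -> ZhatM) : Prop :=
  measurable_fun setT X /\
  forall (t : Zhat) (B : set ZhatM), measurable B ->
    P (X @^-1` ztranslate t B) = P (X @^-1` B).

Definition mutually_independent (I : finType) (X : I -> Omega -> ZhatM) : Prop :=
  forall (J : {set I}) (B : I -> set ZhatM), (forall i, measurable (B i)) ->
    P (\bigcap_(i in [set` J]) (X i @^-1` B i)) =
    (\prod_(i in J) P (X i @^-1` B i))%E.

End RandomMatrix.

Definition zhat_mx_surjective (n k : nat) (A : 'I_n -> 'I_k -> Zhat) : Prop :=
  forall y : 'I_n -> Zhat, exists x : 'I_k -> Zhat,
    forall i, \big[zadd/zzero]_(j < k) zmul (A i j) (x j) = y i.

Definition zeta {R : realType} (k : nat) : R :=
  limn (series (fun m : nat => ((m.+1)%:R ^+ k)^-1 : R))%R.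

(* Main.v *)
Require Import Defs.
From HB Require Import structures.
From mathcomp Require Import all_boot all_order all_algebra.
From mathcomp Require Import mxabelem.
From mathcomp Require Import all_classical all_reals all_analysis.
From mathcomp Require Import ring lra.
From mathcomp Require Import zify.
Set Implicit Arguments. Unset Strict Implicit. Unset Printing Implicit Defensive.
Import Order.TTheory GRing.Theory Num.Theory.
Import numFieldNormedType.Exports.
Local Open Scope classical_set_scope.
Local Open Scope ring_scope.

(* A is surjective over Zhat iff its reduction modulo every prime p has full row
   rank: solutions modulo m are corrected one prime factor of m at a time, and
   solutions modulo l! are refined compatibly as l grows.  Haar measure makes the
   residues of the entries modulo N independent and uniform, so by the Chinese
   remainder theorem full rank modulo all primes p < N has probability
   \prod_(p < N) \prod_(u < k <= n + u) (1 - p^-k), the inner product being the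
   proportion of full-rank n x (n+u) matrices over F_p.  Letting N grow and using
   the Euler product, A is surjective with probability exactly
   \prod_(u < k <= n + u) zeta(k)^-1 if u > 0; if u = 0 and n > 0 the factor k = 1
   makes it 0, since the harmonic series diverges. *)

(** * Counting matrices of full row rank over a finite field *)

Lemma row_free_col_mx (F : fieldType) m n (u : 'rV[F]_n) (B : 'M[F]_(m, n)) :
  row_free (col_mx u B) = row_free B && ~~ (u <= B)%MS.
Proof.
rewrite /row_free -(addsmxE u B).
have [uB|uB] := boolP (u <= B)%MS.
  rewrite (addsmx_idPr uB) andbF.
  by apply/negbTE; rewrite neq_ltn add1n ltnS rank_leq_row.
rewrite andbT.
have lt : (\rank B < \rank (u + B)%MS)%N.
  by rewrite (ltn_leqif (mxrank_leqif_sup (addsmxSr u B))) addsmx_sub submx_refl andbT.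
have le : (\rank (u + B)%MS <= 1 + \rank B)%N.
  apply: leq_trans (_ : \rank u + \rank B <= _)%N; last by rewrite leq_add2r rank_leq_row.
  by rewrite -mxrank_sum_cap leq_addr.
have -> : \rank (u + B)%MS = (1 + \rank B)%N by apply/eqP; rewrite eqn_leq le add1n.
by rewrite eqn_add2l.
Qed.

(** Split off the first row: the remaining [m] independent rows span [#|F| ^ m] vectors, and the
    first row may be any vector outside this span. *)
Lemma card_row_freeS (F : finFieldType) m n :
  (#|[set A : 'M[F]_(m.+1, n) | row_free A]%SET| =
   #|[set A : 'M[F]_(m, n) | row_free A]%SET| * (#|F| ^ n - #|F| ^ m))%N.
Proof.
rewrite -sum_nat_const -sum1_card.
rewrite (reindex (fun p : 'M[F]_(m, n) * 'rV[F]_n => col_mx p.2 p.1 : 'M[F]_(1 + m, n))) /=;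
  last first.
  exists (fun A : 'M[F]_(1 + m, n) => (dsubmx A, usubmx A)) => [[B v] _|A _] /=.
    by rewrite col_mxKu col_mxKd.
  by rewrite vsubmxK.
rewrite (eq_bigl (fun p : 'M[F]_(m, n) * 'rV[F]_n =>
    (p.1 \in [set A : 'M[F]_(m, n) | row_free A]%SET) && ~~ (p.2 <= p.1)%MS)); last first.
  by case=> B v; rewrite !inE row_free_col_mx.
rewrite -(pair_big_dep _ (fun (B : 'M[F]_(m, n)) (v : 'rV[F]_n) => ~~ (v <= B)%MS)
  (fun _ _ => 1%N)) /=.
apply: eq_bigr => B BS.
have /[!inE] Bfree : B \in [set A : 'M[F]_(m, n) | row_free A]%SET := BS.
rewrite sum1_card.
have -> : #|[pred v : 'rV[F]_n | ~~ (v <= B)%MS]| = #|~: rowg B|.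
  by apply: eq_card => v; rewrite [RHS]finset.in_setC mem_rowg.
by rewrite cardsCs finset.setCK card_rowg (eqP Bfree) card_mx mul1n.
Qed.

Lemma row_free_density (K : numFieldType) (F : finFieldType) m u :
  #|[set A : 'M[F]_(m, m + u) | row_free A]%SET|%:R / (#|F| ^ (m * (m + u)))%:R
  = \prod_(u.+1 <= k < (m + u).+1) (1 - (#|F|%:R ^+ k)^-1) :> K.
Proof.
have F0 : (0 < #|F|)%N by apply/card_gt0P; exists 0.
have FK : #|F|%:R != 0 :> K by rewrite pnatr_eq0 -lt0n.
(* The number [n] of columns stays fixed in the induction on [m], so [u] grows by one as a row is
   removed. The removed row contributes the lowest factor, [k = u.+1]. *)
have [n En] : exists n, (m + u)%N = n by eexists.
rewrite En; elim: m u En => [|m IHm] u En.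
  rewrite -En big_geq // mul0n expn0 divr1.
  rewrite (_ : [set A : 'M[F]_(0, 0 + u) | row_free A]%SET = [set: 'M[F]_(0, 0 + u)]%SET).
    by rewrite cardsT card_mx mul0n expn0.
  by apply/finset.setP => A; rewrite !inE /row_free flatmx0 mxrank0.
have := IHm u.+1; rewrite addnS -addSn En => /(_ erefl) IH.
rewrite card_row_freeS big_ltn; last by rewrite -En; lia.
rewrite -IH mulSn expnD !natrM natrB ?leq_pexp2l//; last by rewrite -En; lia.
rewrite !natrX.
have -> : #|F|%:R ^+ n = #|F|%:R ^+ m * #|F|%:R ^+ u.+1 :> K.
  by rewrite -exprD; congr (_ ^+ _); lia.
field; rewrite ?expf_neq0 //.
Qed.

(** * Solving integer linear systems modulo m *)

(* If M x0 = y + p z0 and M x1 = - z0 + (m/p) z1, then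
   M (x0 + p x1) = y + m z1. *)
Lemma int_mx_surj_mod n k (M : 'M[int]_(n, k)) m :
  (0 < m)%N ->
  (forall p, prime p -> (p %| m)%N -> row_free (map_mx intr M : 'M['F_p]_(n, k))) ->
  forall y : 'cV[int]_n, exists (x : 'cV[int]_k) (z : 'cV[int]_n),
    M *m x = y + m%:Z *: z.
Proof.
elim/ltn_ind: m => m IHm m0 Mfree y.
have [m1|m1] := leqP m 1.
  have -> : m = 1%N by lia.
  by exists 0, (- y); rewrite mulmx0 scale1r subrr.
have pp := pdiv_prime m1; set p := pdiv m in pp.
have pm : (p %| m)%N by exact: pdiv_dvd.
have [B MB] := row_freeP (Mfree p pp pm).
have [x0 [z0 E0]] : exists (x : 'cV[int]_k) (z : 'cV[int]_n), M *m x = y + p%:Z *: z.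
  (* [x] lifts to the integers the solution [B y] modulo [p], where [B] is a right inverse of [M]
     modulo [p]. *)
  pose x : 'cV[int]_k := \col_j (nat_of_ord ((B *m map_mx intr y) j 0))%:Z.
  exists x, (\col_i ((M *m x - y) i 0%R %/ p%:Z)%Z).
  apply/matrixP => i j; rewrite ord1 {j}.
  have : (p%:Z %| (M *m x - y) i 0%R)%Z.
    rewrite (dvdz_pcharf (pchar_Fp pp)).
    have -> : ((M *m x - y) i 0%R)%:~R = (map_mx intr (M *m x - y) : 'cV['F_p]_n) i 0.
      by rewrite [RHS]mxE.
    rewrite map_mxB map_mxM (_ : map_mx intr x = B *m map_mx intr y) ?mulmxA ?MB ?mul1mx ?subrr ?mxE //.
    apply/matrixP => a b; rewrite ord1 {b} [LHS]mxE [in LHS]mxE.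
    by rewrite -[RHS]natr_Zp.
  move=> /divzK E; rewrite [RHS]mxE [X in _ + X]mxE [X in _ + _ * X]mxE mulrC E.
  by rewrite [(M *m x - y) i 0]mxE [(- y) i 0]mxE subrKC.
have m'0 : (0 < m %/ p)%N by rewrite divn_gt0 ?prime_gt0 // dvdn_leq.
have m'm : (m %/ p < m)%N by rewrite ltn_Pdiv ?prime_gt1.
have [x1 [z1 E1]] := IHm _ m'm m'0
  (fun q qp qm => Mfree q qp (dvdn_trans qm (dvdn_div pm))) (- z0).
exists (x0 + p%:Z *: x1), z1.
rewrite mulmxDr -scalemxAr E0 E1 scalerDr scalerN scalerA -PoszM mulnC divnK //.
by rewrite -!addrA; congr (_ + _); rewrite addrA subrr add0r.
Qed.

(** * Residues of profinite integers and the criterion for surjectivity *)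

Lemma zres_lt (x : Zhat) m : (zres x m < m.+1)%N.
Proof. by case: x => x [lt_x ?]; exact: lt_x. Qed.

Lemma zres_mod (x : Zhat) m d : (d.+1 %| m.+1)%N -> (zres x m %% d.+1)%N = zres x d.
Proof. by case: x => x [? cx]; exact: cx. Qed.

Lemma zhat_ext (x y : Zhat) : zres x =1 zres y -> x = y.
Proof. by case: x y => [x ?] [y ?] xy; apply: eq_exist; apply/funext. Qed.

Lemma zres_dvdz_eq (x y : Zhat) m :
  (m.+1%:Z %| (zres x m)%:Z - (zres y m)%:Z)%Z -> zres x m = zres y m.
Proof.
rewrite -eqz_mod_dvd !modz_nat !modn_small ?zres_lt // eqz_nat.
exact: eqP.
Qed.

Lemma zres_sum (I : Type) (r : seq I) (F : I -> Zhat) m :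
  zres (\big[zadd/zzero]_(j <- r) F j) m = ((\sum_(j <- r) zres (F j) m) %% m.+1)%N.
Proof.
elim: r => [|j r IHr]; first by rewrite !big_nil mod0n.
by rewrite !big_cons -modnDmr -IHr.
Qed.

Lemma zhat_compat_nat a : zhat_compat (fun m => a %% m.+1)%N.
Proof. by split=> [m|m d dm]; rewrite ?ltn_pmod // modn_dvdm. Qed.

Definition znat (a : nat) : Zhat := exist _ _ (zhat_compat_nat a).

(* Indices of residues are shifted: [zres x m] is the residue modulo m.+1, so the
   residues modulo p and modulo l! are [zres x p.-1] and [zres x l`!.-1]. *)
Definition zres_mx n k (A : 'I_n -> 'I_k -> Zhat) m : 'M[int]_(n, k) :=
  \matrix_(i, j) (zres (A i j) m)%:Z.

(** The entries are natural numbers, so that residues modulo any multiple of [p] can be inserted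
    directly. *)
Definition row_free_mod n k (p : nat) (f : 'I_n * 'I_k -> nat) : bool :=
  row_free (\matrix_(i, j) (f (i, j))%:R : 'M['F_p]_(n, k)).

Lemma natr_Fp_modn p a b : prime p -> a = b %[mod p] -> a%:R = b%:R :> 'F_p.
Proof. by move=> pp ab; rewrite -(Fp_nat_mod pp a) ab Fp_nat_mod. Qed.

Lemma row_free_mod_eq n k p (f g : 'I_n * 'I_k -> nat) : prime p ->
  (forall ij, f ij = g ij %[mod p]) -> row_free_mod p f = row_free_mod p g.
Proof.
move=> pp fg; congr row_free; apply/matrixP => i j; rewrite !mxE.
exact: natr_Fp_modn.
Qed.

(** Preimages of the standard basis vectors, reduced modulo [p], are the columns of a right
    inverse. *)
Lemma zhat_mx_surjective_mod n k (A : 'I_n -> 'I_k -> Zhat) p : prime p ->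
  zhat_mx_surjective A -> row_free_mod p (fun ij => zres (A ij.1 ij.2) p.-1).
Proof.
move=> pp Asurj; have p0 := prime_gt0 pp.
have /choice[X XE] : forall i0 : 'I_n, exists x : 'I_k -> Zhat,
    forall i, \big[zadd/zzero]_(j < k) zmul (A i j) (x j) = znat (i == i0).
  by move=> i0; exact: Asurj.
apply/row_freeP; exists (\matrix_(j, i) (zres (X i j) p.-1)%:R).
apply/matrixP => i i0; rewrite [LHS]mxE [RHS]mxE.
have := congr1 (fun z => (zres z p.-1)%:R : 'F_p) (XE i0 i).
rewrite zres_sum /= prednK // !Fp_nat_mod // natr_sum => <-.
apply: eq_bigr => j _; rewrite !mxE.
by rewrite -natrM; apply: natr_Fp_modn => //; rewrite modn_mod.
Qed.

Lemma zres_mx_fact n k (A : 'I_n -> 'I_k -> Zhat) l : exists N,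
  zres_mx A (l.+1)`!.-1 = zres_mx A l`!.-1 + l`!%:Z *: N.
Proof.
exists (\matrix_(i, j) (zres (A i j) (l.+1)`!.-1 %/ l`!)%:Z).
apply/matrixP => i j; rewrite !mxE -PoszM -PoszD; congr Posz.
have E (q : nat) : q`!.-1.+1 = q`! by rewrite prednK ?fact_gt0.
rewrite -(@zres_mod _ (l.+1)`!.-1 l`!.-1) !E; last by rewrite factS dvdn_mull.
by rewrite addnC mulnC -divn_eq.
Qed.

(** Passing from l! to (l+1)! changes the residues of A and y by l! N and l! N', so the error of x
    becomes l! (z + N x - N'). Adding l! w to x cancels it modulo (l+1)! once A w = N' - N x - z
    modulo l+1, which is solvable by [int_mx_surj_mod]. *)
Lemma zres_mx_solve_factS n k (A : 'I_n -> 'I_k -> Zhat) (y : 'I_n -> Zhat) :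
  (forall p, prime p -> row_free_mod p (fun ij => zres (A ij.1 ij.2) p.-1)) ->
  forall l x z,
    zres_mx A l`!.-1 *m x = zres_mx (fun i (_ : 'I_1) => y i) l`!.-1 + l`!%:Z *: z ->
  exists w z', zres_mx A (l.+1)`!.-1 *m (x + l`!%:Z *: w) =
    zres_mx (fun i (_ : 'I_1) => y i) (l.+1)`!.-1 + (l.+1)`!%:Z *: z'.
Proof.
move=> Afree l x z Ex.
have [N EN] := zres_mx_fact A l.
have [N' EN'] := zres_mx_fact (fun i (_ : 'I_1) => y i) l.
have M_free p : prime p -> (p %| l.+1)%N ->
    row_free (map_mx intr (zres_mx A (l.+1)`!.-1) : 'M['F_p]_(n, k)).
  move=> pp pl; have := Afree p pp; rewrite /row_free_mod; congr row_free.
  apply/matrixP => i j; rewrite !mxE /=; apply: natr_Fp_modn => //.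
  have p0 := prime_gt0 pp.
  rewrite -(@zres_mod _ (l.+1)`!.-1 p.-1) prednK ?modn_mod //.
  by rewrite prednK ?fact_gt0 // factS dvdn_mulr.
have [w [z' Ew]] := int_mx_surj_mod (ltn0Sn l) M_free (N' - N *m x - z).
exists w, z'; rewrite mulmxDr -scalemxAr Ew {1}EN EN' mulmxDl -scalemxAl Ex.
rewrite factS mulnC PoszM -scalerA !scalerDr !scalerN.
set a := l`!%:Z *: (N *m x); set b := l`!%:Z *: z; set c := l`!%:Z *: N'.
apply/matrixP => i j; rewrite !mxE; ring.
Qed.

Lemma zhat_mx_surjectiveP n k (A : 'I_n -> 'I_k -> Zhat) :
  zhat_mx_surjective A <->
  forall p, prime p -> row_free_mod p (fun ij => zres (A ij.1 ij.2) p.-1).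
Proof.
split=> [Asurj p pp|Afree y]; first exact: zhat_mx_surjective_mod.
pose Y := zres_mx (fun i (_ : 'I_1) => y i).
pose Q l (x : 'cV[int]_k) := exists z, zres_mx A l`!.-1 *m x = Y l`!.-1 + l`!%:Z *: z.
(* Choice yields a total refinement function; where [x] is no solution modulo [l!], the value is an
   arbitrary 0. *)
have /choice[f fP] : forall lx : nat * 'cV[int]_k, exists x', Q lx.1 lx.2 ->
    Q lx.1.+1 x' /\ exists w, x' = lx.2 + lx.1`!%:Z *: w.
  case=> l x /=; have [[z Ez]|nQ] := pselect (Q l x); last by exists 0 => /nQ.
  have [w [z' E']] := zres_mx_solve_factS Afree Ez.
  by exists (x + l`!%:Z *: w) => _; split; [exists z'|exists w].
pose fix X l : 'cV[int]_k := if l is l'.+1 then f (l', X l') else 0.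
have QX l : Q l (X l).
  elim: l => [|l IHl]; last exact: (fP (l, X l) IHl).1.
  by exists (- Y 0`!.-1); rewrite mulmx0 scale1r subrr.
(* All later approximations agree with [X l] modulo l!, so the sequence converges in the profinite
   integers. *)
have XD l t : exists w, X (l + t)%N = X l + l`!%:Z *: w.
  elim: t => [|t [w Ew]]; first by exists 0; rewrite addn0 scaler0 addr0.
  have [_ [w' Ew']] := fP ((l + t)%N, X (l + t)%N) (QX _).
  have /dvdnP[q Eq] : (l`! %| (l + t)`!)%N by rewrite -(@bin_fact (l + t) l) ?leq_addr // mulnCA dvdn_mulr.
  exists (w + q%:Z *: w'); rewrite addnS /= Ew' /= Ew Eq PoszM.
  by rewrite scalerDr scalerA [_ * q%:Z]mulrC addrA.
(* The residue modulo m+1 is read off from [X m.+1], which is determined modulo (m+1)!, a multiple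
   of m+1. *)
pose xl j m := `|(X m.+1 j 0%R %% m.+1%:Z)%Z|%N.
have xlE j m : (xl j m)%:Z = (X m.+1 j 0%R %% m.+1%:Z)%Z.
  by rewrite /xl gez0_abs // modz_ge0.
have xl_compat j : zhat_compat (xl j).
  split=> [m|m d dm]; first by rewrite -ltz_nat xlE ltz_pmod.
  have [t Et] : exists t, m = (d + t)%N.
    by exists (m - d)%N; rewrite subnKC //; have := dvdn_leq (ltn0Sn m) dm.
  apply/eqP; rewrite -eqz_nat -modz_nat !xlE eqz_mod_dvd [in X in X - _]/modz addrAC.
  rewrite rpredB ?dvdz_mull // Et -addSn.
  have [w ->] := XD d.+1 t.
  by rewrite mxE [(_ *: w) j 0%R]mxE addrAC subrr add0r factS PoszM -mulrA dvdz_mulr.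
exists (fun j => exist _ _ (xl_compat j)) => i; apply: zhat_ext => m.
apply: zres_dvdz_eq.
(* Four congruences modulo [D] are chained: from [s] to the integer sum of products of residues, to
   the row of the system at level (m+1)!, to [y'], to the residue of [y i]. *)
set D := m.+1%:Z; set s := zres _ m; set y' := zres (y i) (m.+1)`!.-1.
have mf : (m.+1 %| (m.+1)`!.-1.+1)%N by rewrite prednK ?fact_gt0 // factS dvdn_mulr.
have modz_sub (a : nat) : (D %| a%:Z - (a %% m.+1)%N%:Z)%Z.
  by rewrite -eqz_mod_dvd -modz_nat modz_mod.
have hs : (D %| s%:Z - (\sum_(j < k) zres (A i j) m * xl j m)%N%:Z)%Z.
  rewrite /s zres_sum -opprB rpredN.
  rewrite -eqz_mod_dvd !modz_nat modn_mod eqz_nat; apply/eqP.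
  by elim/big_ind2: _ => // [a b c e ab ce|j _]; [rewrite -modnDm ab ce modnDm|rewrite modn_mod].
have hx : (D %| (\sum_(j < k) zres (A i j) m * xl j m)%N%:Z -
    (zres_mx A (m.+1)`!.-1 *m X m.+1) i 0%R)%Z.
  rewrite mxE (big_morph Posz PoszD erefl) -sumrB rpred_sum // => j _; rewrite mxE PoszM.
  rewrite -eqz_mod_dvd xlE modzMmr -(zres_mod (A i j) mf) -modz_nat modzMml.
  by [].
have hy : (D %| (zres_mx A (m.+1)`!.-1 *m X m.+1) i 0%R - y'%:Z)%Z.
  have [z ->] := QX m.+1.
  by rewrite mxE [Y _ i 0%R]mxE [(_ *: z) i 0%R]mxE addrAC subrr add0r factS PoszM -mulrA dvdz_mulr.
have hm : (D %| y'%:Z - (zres (y i) m)%:Z)%Z by rewrite -(zres_mod (y i) mf).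
have := rpredD (rpredD hs hx) (rpredD hy hm).
by rewrite !addrA !subrK.
Qed.

(** * The Euler product of the zeta function, by sieving partial sums *)

Section EulerProduct.
Context {R : realType}.

(** A partial sum of the zeta series, sieved by [r]. Keeping [M] finite makes the sieve available
    also at [s = 1], where the series diverges. *)
Definition coprime_sum (s : nat) (r : seq nat) (M : nat) : R :=
  \sum_(1 <= m < M.+1 | all (coprime m) r) (m%:R ^+ s)^-1.

Lemma coprime_sumS s r M : coprime_sum s r M.+1 =
  coprime_sum s r M + if all (coprime M.+1) r then (M.+1%:R ^+ s)^-1 else 0.
Proof. by rewrite /coprime_sum big_mkcond big_nat_recr //= -big_mkcond. Qed.

(* The sieve step: the terms removed are those with m = p m', m' <= M / p. *)
Lemma coprime_sum_cons s r p M : prime p -> all prime r -> p \notin r ->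
  coprime_sum s (p :: r) M =
  coprime_sum s r M - (p%:R ^+ s)^-1 * coprime_sum s r (M %/ p).
Proof.
move=> pp /allP pr pNr.
elim: M => [|M IHM].
  by rewrite div0n /coprime_sum !(big_geq (leqnn 1)) mulr0 subr0.
rewrite !coprime_sumS IHM (divnS _ (prime_gt0 pp)) /=.
rewrite coprime_sym prime_coprime //.
have [pM|pM] /= := boolP (p %| M.+1)%N; last by rewrite addrAC.
have qE : (M.+1 = p * (M %/ p).+1)%N.
  by rewrite -[LHS](divnK pM) (divnS _ (prime_gt0 pp)) pM add1n mulnC.
rewrite add1n coprime_sumS addr0.
(* Multiplying by [p] does not affect coprimality to the other primes, so the new term of the first
   sum and the new multiple of [p] cancel. *)
rewrite (_ : all (coprime M.+1) r = all (coprime (M %/ p).+1) r).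
  case: ifP => _; last by rewrite !addr0.
  by rewrite qE natrM exprMn invfM; ring.
apply: eq_in_all => x xr; rewrite qE coprimeMl prime_coprime //.
rewrite (dvdn_prime2 pp (pr x xr)) (_ : p != x) //.
by apply: contraNneq pNr => ->.
Qed.

Lemma le_coprime_sum s r M N : (M <= N)%N -> coprime_sum s r M <= coprime_sum s r N.
Proof.
move=> MN; rewrite /coprime_sum [leRHS](@big_cat_nat _ _ _ M.+1) //=.
by rewrite lerDl sumr_ge0 // => m _; rewrite invr_ge0 exprn_ge0.
Qed.

Lemma euler_factor_ge0 s p : prime p -> 0 <= 1 - (p%:R ^+ s)^-1 :> R.
Proof.
move=> pp; rewrite subr_ge0 invf_le1 ?exprn_gt0 ?ltr0n ?prime_gt0 //.
by rewrite exprn_ege1 // ler1n prime_gt0.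
Qed.

(** Sieving by p subtracts p^-s times a sum up to M/p, at most p^-s times the sum up to M, so at
    least the proportion 1 - p^-s remains. *)
Lemma euler_prod_mul_le s r M : all prime r -> uniq r ->
  \prod_(p <- r) (1 - (p%:R ^+ s)^-1) * coprime_sum s [::] M <= coprime_sum s r M.
Proof.
elim: r => [|p r IHr]; first by rewrite big_nil mul1r.
move=> /= /andP[pp pr] /andP[pNr ur]; rewrite big_cons -mulrA.
apply: le_trans (ler_wpM2l (euler_factor_ge0 s pp) (IHr pr ur)) _.
rewrite coprime_sum_cons // mulrBl mul1r lerD2l lerN2.
by rewrite ler_wpM2l ?invr_ge0 ?exprn_ge0 // le_coprime_sum // leq_div.
Qed.

(** The partial Euler product of 1/zeta(s), not of zeta(s). *)
Definition euler_prod (s N : nat) : R :=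
  \prod_(0 <= p < N | prime p) (1 - (p%:R ^+ s)^-1).

Lemma euler_prodE s N : euler_prod s N =
  \prod_(p <- [seq p <- index_iota 0 N | prime p]) (1 - (p%:R ^+ s)^-1).
Proof. by rewrite big_filter. Qed.

(** Every m with 1 < m <= M has a prime factor at most M, so only the term m = 1 can survive. *)
Lemma coprime_sum_primes_le1 s M :
  coprime_sum s [seq p <- index_iota 0 M.+1 | prime p] M <= 1.
Proof.
rewrite /coprime_sum big_mkcond.
apply: (@le_trans _ _ (\sum_(1 <= m < M.+1) (m == 1%N)%:R)).
  apply: ler_sum_nat => m /andP[m0 mM].
  have [->|m1] := eqVneq m 1%N; first by rewrite expr1n invr1; case: ifP.
  case: ifP => // /allP /(_ (pdiv m)).
  have m_gt1 : (1 < m)%N by lia.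
  rewrite mem_filter mem_index_iota pdiv_prime //= (leq_ltn_trans (pdiv_leq m0)) // => /(_ isT).
  by rewrite coprime_sym prime_coprime ?pdiv_prime // pdiv_dvd.
case: M => [|M]; first by rewrite big_geq.
by rewrite big_ltn // big_nat big1 ?addr0 // => m /andP[m1 _]; rewrite gtn_eqF.
Qed.

Lemma coprime_sum_nil s M :
  coprime_sum s [::] M = series (fun m => ((m.+1)%:R ^+ s)^-1) M.
Proof. by rewrite /coprime_sum /series /= big_add1. Qed.

Lemma coprime_sum_ge1 s r M : (0 < M)%N -> 1 <= coprime_sum s r M.
Proof.
case: M => // M _; rewrite /coprime_sum big_ltn_cond //=.
have -> : all (coprime 1) r by apply/allP => x _; rewrite coprime1n.
rewrite expr1n invr1 lerDl sumr_ge0 // => m _; by rewrite invr_ge0 exprn_ge0.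
Qed.

Lemma euler_prod_upper s M : (0 < M)%N ->
  euler_prod s M.+1 <= (series (fun m => ((m.+1)%:R ^+ s)^-1) M)^-1.
Proof.
move=> M0; rewrite -coprime_sum_nil.
have H0 : 0 < coprime_sum s [::] M := lt_le_trans ltr01 (coprime_sum_ge1 s [::] M0).
rewrite -[leRHS]mul1r ler_pdivlMr // euler_prodE.
apply: le_trans (coprime_sum_primes_le1 s M).
by apply: euler_prod_mul_le; rewrite ?filter_all ?filter_uniq ?iota_uniq.
Qed.

Lemma is_cvg_zeta s : (1 < s)%N -> cvgn (series (fun m => ((m.+1)%:R ^+ s)^-1 : R)).
Proof.
move=> s1; apply: nondecreasing_is_cvgn.
  by apply: nondecreasing_series => m _ _; rewrite invr_ge0 exprn_ge0.
exists 2 => _ [M _ <-].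
(* Telescoping: the term following those summed here is at most 1/((M+1)(M+2)) = 1/(M+1) -
   1/(M+2). *)
suff : series (fun m => ((m.+1)%:R ^+ s)^-1) M.+1 <= 2 - M.+1%:R^-1 :> R.
  move=> le2; apply: le_trans (_ : series (fun m => ((m.+1)%:R ^+ s)^-1) M.+1 <= _).
    by rewrite seriesSr /= lerDl invr_ge0 exprn_ge0.
  by apply: le_trans le2 _; rewrite gerBl invr_ge0.
elim: M => [|M IHM].
  by rewrite /series /= big_nat1 expr1n invr1; lra.
rewrite seriesSr /=; apply: le_trans (lerD IHM (_ : _ <= (M.+1%:R * M.+2%:R)^-1)) _.
  rewrite lef_pV2 ?posrE ?exprn_gt0 ?mulr_gt0 ?ltr0n //.
  apply: (@le_trans _ _ (M.+2%:R ^+ 2)); last by rewrite ler_eXn2l ?ltr1n.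
  by rewrite expr2 ler_wpM2r // ler_nat.
have x0 : 0 < M.+1%:R :> R by [].
rewrite -[M.+2%:R]natr1; move: x0; move: (M.+1%:R : R) => x x0.
by rewrite -subr_ge0 (_ : _ - _ = 0) //; field; apply/andP; split; lra.
Qed.

(** Limit of the sieve identity: M/p tends to infinity with M, so each prime multiplies the limit by
    1 - p^-s. *)
Lemma cvg_coprime_sum s r : (1 < s)%N -> all prime r -> uniq r ->
  coprime_sum s r @ \oo --> (zeta s : R) * \prod_(p <- r) (1 - (p%:R ^+ s)^-1).
Proof.
move=> s1; elim: r => [|p r IHr].
  move=> _ _; rewrite big_nil mulr1.
  have -> : coprime_sum s [::] = series (fun m => ((m.+1)%:R ^+ s)^-1).
    by apply/funext => M; rewrite coprime_sum_nil.
  exact: is_cvg_zeta.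
move=> /= /andP[pp pr] /andP[pNr ur]; rewrite big_cons.
have cr := IHr pr ur.
have p0 := prime_gt0 pp.
rewrite (_ : coprime_sum s (p :: r) =
  fun M => coprime_sum s r M - (p%:R ^+ s)^-1 * coprime_sum s r (M %/ p)); last first.
  by apply/funext => M; rewrite coprime_sum_cons.
rewrite mulrCA mulrBl mul1r; apply: cvgB => //; apply: cvgMr => //.
exact: cvg_comp (cvg_divnr _ p0) cr.
Qed.

(** The right-hand side is the limit of the sums sieved by the primes below [N], each of which keeps
    the term 1. *)
Lemma euler_prod_lower s N : (1 < s)%N -> 1 <= (zeta s : R) * euler_prod s N.
Proof.
move=> s1; rewrite euler_prodE.
have c := @cvg_coprime_sum s [seq p <- index_iota 0 N | prime p] s1
  (filter_all _ _) (filter_uniq _ (iota_uniq _ _)).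
rewrite -(cvg_lim (@Rhausdorff R) c); apply: limr_ge; first by apply/cvg_ex; eexists; exact: c.
by exists 1%N => // M /= M0; exact: coprime_sum_ge1.
Qed.

Lemma zeta_ge1 s : (1 < s)%N -> 1 <= zeta s :> R.
Proof.
move=> s1; have := euler_prod_lower 0 s1.
by rewrite /euler_prod big_geq // mulr1.
Qed.

Lemma cvg_euler_prod s : (1 < s)%N -> euler_prod s @ \oo --> (zeta s : R)^-1.
Proof.
move=> s1; have z0 : 0 < (zeta s : R) := lt_le_trans ltr01 (zeta_ge1 s1).
(* The upper bound concerns [euler_prod s M.+1] with [M > 0], hence indices from 2 on. *)
rewrite -(cvg_shiftn 2).
apply: (@squeeze_cvgr _ _ _ _ (cst (zeta s)^-1) (fun M =>
  (series (fun m => ((m.+1)%:R ^+ s)^-1) (M + 1)%N)^-1)); first 1 last.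
- exact: cvg_cst.
- by apply: cvgV; rewrite ?gt_eqF // cvg_shiftn; exact: is_cvg_zeta.
apply: nearW => M /=.
apply/andP; split; last by rewrite addn2 addn1; exact: euler_prod_upper.
by rewrite -[leLHS]mul1r ler_pdivrMr // mulrC euler_prod_lower.
Qed.

(** The upper bound at [s = 1] is the inverse of a partial harmonic sum, which tends to infinity. *)
Lemma cvg_euler_prod1 : euler_prod 1 @ \oo --> (0 : R).
Proof.
rewrite -(cvg_shiftn 2).
apply: (@squeeze_cvgr _ _ _ _ (cst 0) (fun M => (series harmonic (M + 1)%N)^-1));
  first 1 last.
- exact: cvg_cst.
- have nd : nondecreasing_seq (series (@harmonic R)).
    by apply: nondecreasing_series => m _ _; exact: harmonic_ge0.
  have := nondecreasing_dvgn_lt nd (@dvg_harmonic R).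
  rewrite -(cvg_shiftn 1) => /gtr0_cvgV0; apply.
  apply: nearW => M; rewrite [X in 0 < X]/= addn1.
  by rewrite /series /= big_ltn //= ltr_wpDr ?invr1 // sumr_ge0 // => m _; exact: harmonic_ge0.
apply: nearW => M; apply/andP; split.
  by apply: prodr_ge0 => p pp; exact: euler_factor_ge0.
by rewrite [leLHS]/= addn2 addn1; have := @euler_prod_upper 1 M.+1 isT; rewrite /harmonic.
Qed.

End EulerProduct.

(** * Densities of conditions on residues *)

Definition residue_density (K : numFieldType) (I : finType) (q : nat)
    (T : (I -> nat) -> bool) : K :=
  #|[pred f : {ffun I -> 'I_q} | T (fun i => f i)]|%:R / (q ^ #|I|)%:R.

(** Chinese remaindering in each coordinate is a bijection that carries the joint condition to a
    product set. It is injective, and bijective by cardinality. *)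
Lemma residue_density_coprime (K : numFieldType) (I : finType) a b
    (Ta Tb : (I -> nat) -> bool) : (0 < a)%N -> (0 < b)%N -> coprime a b ->
  (forall f, Ta (fun i => f i %% a)%N = Ta f) ->
  (forall f, Tb (fun i => f i %% b)%N = Tb f) ->
  residue_density K (a * b) (fun f => Ta f && Tb f) =
  residue_density K a Ta * residue_density K b Tb.
Proof.
move=> a0 b0 ab Taa Tbb; rewrite /residue_density expnMn natrM mulf_div; congr (_ / _).
rewrite -natrM; congr (_%:R).
pose phi (f : {ffun I -> 'I_(a * b)}) : {ffun I -> 'I_a} * {ffun I -> 'I_b} :=
  ([ffun i => Ordinal (ltn_pmod (f i) a0)], [ffun i => Ordinal (ltn_pmod (f i) b0)]).
have phi_inj : injective phi.
  move=> f g [] /ffunP fga /ffunP fgb; apply/ffunP => i; apply: val_inj => /=.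
  have /eqP := congr1 val (fga i); have /eqP := congr1 val (fgb i).
  rewrite !ffunE /= => eb ea.
  have : f i == g i %[mod a * b] by rewrite chinese_remainder // ea eb.
  by rewrite !modn_small // => /eqP.
have phi_bij : bijective phi.
  by apply: inj_card_bij => //; rewrite card_prod !card_ffun !card_ord expnMn.
rewrite -cardX.
rewrite -[RHS](on_card_preimset (f := phi)); last exact: onW_bij.
apply: eq_card => f; rewrite !inE -Taa -Tbb /=.
by congr (Ta _ && Tb _); apply/funext => i; rewrite ffunE.
Qed.

Lemma residue_density_prime (K : numFieldType) n u p : prime p ->
  residue_density K p (@row_free_mod n (n + u) p) =
  \prod_(u.+1 <= k < (n + u).+1) (1 - (p%:R ^+ k)^-1).
Proof.
move=> pp; have := row_free_density K 'F_p n u; rewrite (card_Fp pp) => <-.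
rewrite /residue_density card_prod !card_ord; congr (_%:R / _).
pose phi (f : {ffun 'I_n * 'I_(n + u) -> 'I_p}) : 'M['F_p]_(n, n + u) :=
  \matrix_(i, j) (val (f (i, j)))%:R.
have phi_inj : injective phi.
  move=> f g /matrixP fg; apply/ffunP => -[i j]; apply: val_inj.
  have := congr1 (fun x : 'F_p => nat_of_ord x) (fg i j).
  by rewrite !mxE !val_Fp_nat // !modn_small ?ltn_ord.
have phi_bij : bijective phi.
  by apply: inj_card_bij => //; rewrite card_mx card_ffun card_Fp // card_ord card_prod !card_ord.
rewrite -[RHS](on_card_preimset (f := phi)); last exact: onW_bij.
by apply: eq_card => f; rewrite !inE.
Qed.

(** The primes are split off one at a time, each being coprime to the product of the remaining
    ones. *)
Lemma residue_density_primes (K : numFieldType) n u r : all prime r -> uniq r ->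
  residue_density K (\prod_(p <- r) p)%N
    (fun f : 'I_n * 'I_(n + u) -> nat => all (fun p => row_free_mod p f) r) =
  \prod_(p <- r) \prod_(u.+1 <= k < (n + u).+1) (1 - (p%:R ^+ k)^-1).
Proof.
elim: r => [|p r IHr].
  move=> _ _; rewrite !big_nil /residue_density exp1n divr1.
  by rewrite (eq_card (_ : _ =i predT)) // card_ffun card_ord exp1n.
move=> /= /andP[pp pr] /andP[pNr ur]; rewrite !big_cons -IHr // -residue_density_prime //.
have r0 : (0 < \prod_(q <- r) q)%N.
  by rewrite big_seq prodn_cond_gt0 // => q /(allP pr) /prime_gt0.
rewrite -residue_density_coprime ?(prime_gt0 pp) //.
- rewrite big_seq; elim/big_ind: _ => // [|x y cx cy|q qr]; rewrite ?coprimen1 ?coprimeMr ?cx ?cy //.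
  rewrite prime_coprime // (dvdn_prime2 pp (allP pr _ qr)) //.
  by apply: contraNneq pNr => ->.
- by move=> f; apply: row_free_mod_eq => // ij; rewrite modn_mod.
- move=> f; apply: eq_in_all => q qr; apply: row_free_mod_eq; first exact: (allP pr).
  move=> ij; by rewrite modn_dvdm // (bigD1_seq q) //= dvdn_mulr.
Qed.

(** * Uniformity and independence of residues under Haar measure *)

Section Probability.
Context {R : realType} {d : measure_display} {Omega : measurableType d}.
Context (P : probability Omega R).

Lemma preimage_fin_bigcup (T : Type) (J : finType) (Y : T -> J) (S : {pred J}) :
  Y @^-1` [set` S] = \bigcup_(j in [set` enum S]) Y @^-1` [set j].
Proof.
apply/seteqP; split=> [w /= Sw|w [j /= jS] /= ->]; last by rewrite mem_enum in jS.
by exists (Y w); rewrite //= mem_enum.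
Qed.

Lemma measure_preimage_fin (J : finType) (Y : Omega -> J) (S : {pred J}) :
  (forall j, measurable (Y @^-1` [set j])) ->
  P (Y @^-1` [set` S]) = (\sum_(j in S) P (Y @^-1` [set j]))%E.
Proof.
move=> mY; rewrite preimage_fin_bigcup.
rewrite measure_fin_bigcup //; first by rewrite -fsbig_seq ?enum_uniq // big_enum.
by move=> i j _ _ [w [/= <- <-]].
Qed.

Lemma measurable_preimage_fin (J : finType) (Y : Omega -> J) (S : {pred J}) :
  (forall j, measurable (Y @^-1` [set j])) -> measurable (Y @^-1` [set` S]).
Proof.
move=> mY; rewrite preimage_fin_bigcup.
exact: fin_bigcup_measurable.
Qed.

Lemma measurable_zres m a : measurable ([set x | zres x m = a] : set ZhatM).
Proof. by apply: sub_sigma_algebra; exists m, a. Qed.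

(* The identity family is -1 in Zhat, as m = -1 modulo m.+1. *)
Lemma zhat_compat_opp1 : zhat_compat id.
Proof.
split=> // m l lm; apply/eqP; rewrite -[X in _ == X](modn_small (ltnSn l)).
by rewrite -(eqn_modDr 1) !addn1 modnn; exact: lm.
Qed.

(** This puts residue classes in the form to which translation invariance applies. *)
Lemma ztranslate_zres m a : (a <= m)%N ->
  ztranslate (znat a) [set x | zres x m = 0%N] = [set x | zres x m = a].
Proof.
move=> am; apply/seteqP; split=> [_ [y /= y0 <-]|x /= xa].
  by rewrite /= -/(zres y m) y0 addn0 modn_mod modn_small.
(* [y] is x - a, formed with the family that represents -1. *)
pose y := zadd x (zmul (exist _ _ zhat_compat_opp1) (znat a)).
exists y.
  rewrite /= -/(zres x m) xa modnMmr modnDmr.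
  by rewrite -mulSn modnMr.
apply: zhat_ext => l; rewrite /= -/(zres x l) modnMmr !modnDmr modnDml.
rewrite addnA modnDmr addnAC -mulSn -modnDml modnMr add0n.
by rewrite modn_small // zres_lt.
Qed.

Lemma measurable_preimage_zres (X : Omega -> ZhatM) m a : haar_distributed P X ->
  measurable (X @^-1` [set x | zres x m = a]).
Proof.
by move=> [mX _]; rewrite -[_ @^-1` _]setTI; exact: mX (measurable_zres _ _).
Qed.

(** The m+1 residue classes are translates of one another, so they have a common probability [r],
    and these add up to 1. *)
Lemma haar_zres (X : Omega -> ZhatM) m a : haar_distributed P X -> (a <= m)%N ->
  P (X @^-1` [set x | zres x m = a]) = (m.+1%:R^-1)%:E.
Proof.
move=> hX am.
pose Y w := Ordinal (zres_lt (X w) m).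
have YE (b : 'I_m.+1) : Y @^-1` [set b] = X @^-1` [set x | zres x m = b].
  by apply/seteqP; split=> w /= => [<- //|E]; apply: val_inj.
have [r Er] : exists r, P (X @^-1` [set x | zres x m = 0%N]) = r%:E.
  exists (fine (P (X @^-1` [set x | zres x m = 0%N]))).
  by rewrite fineK // fin_num_measure //; exact: measurable_preimage_zres.
have PX b : (b <= m)%N -> P (X @^-1` [set x | zres x m = b]) = r%:E.
  by move=> bm; rewrite -ztranslate_zres // (hX.2 _ _ (measurable_zres _ _)).
have PY (b : 'I_m.+1) : P (Y @^-1` [set b]) = r%:E by rewrite YE PX // -ltnS.
have mY b : measurable (Y @^-1` [set b]) by rewrite YE; exact: measurable_preimage_zres.
have : P setT = 1%E by exact: probability_setT.
have -> : [set: Omega] = Y @^-1` [set` (predT : {pred 'I_m.+1})] by apply/seteqP; split.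
rewrite measure_preimage_fin // (eq_bigr _ (fun b _ => PY b)) sumEFin => -[].
rewrite PX //.
rewrite sumr_const card_ord => E; congr (_%:E).
by apply: (@mulIf _ m.+1%:R); rewrite ?pnatr_eq0 // mulr_natr E mulVf ?pnatr_eq0.
Qed.

Section Residues.
Context (I : finType) (X : I -> Omega -> ZhatM) (m : nat)
  (haarX : forall i, haar_distributed P (X i)).

Let residues w : {ffun I -> 'I_m.+1} := [ffun i => Ordinal (zres_lt (X i w) m)].

Let residuesE f : residues @^-1` [set f] =
  \bigcap_(i in [set` [set: I]%SET]) (X i @^-1` [set x | zres x m = f i]).
Proof.
apply/seteqP; split=> [w /= <- i _|w /= E]; first by rewrite /= ffunE.
by apply/ffunP => i; apply: val_inj; rewrite ffunE; apply: E; rewrite /= inE.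
Qed.

Let measurable_residues1 f : measurable (residues @^-1` [set f]).
Proof.
rewrite residuesE; apply: fin_bigcap_measurable => // i _.
exact: measurable_preimage_zres.
Qed.

Let residues_preimage (T : (I -> nat) -> bool) :
  [set w | T (fun i => zres (X i w) m)] =
  residues @^-1` [set` [pred f : {ffun I -> 'I_m.+1} | T (fun i => f i)]].
Proof.
have E w : (fun i => zres (X i w) m) = (fun i => residues w i).
  by apply/funext => i; rewrite ffunE.
by apply/seteqP; split=> w; rewrite /= inE E.
Qed.

Lemma measurable_residues (T : (I -> nat) -> bool) :
  measurable [set w | T (fun i => zres (X i w) m)].
Proof. by rewrite residues_preimage; exact: measurable_preimage_fin. Qed.

(** By independence every value of the family of residues has probability (m+1)^-|I|, so the
    probability of [T] is a normalised count. *)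
Lemma prob_residues (T : (I -> nat) -> bool) : mutually_independent P X ->
  P [set w | T (fun i => zres (X i w) m)] = (residue_density R m.+1 T)%:E.
Proof.
move=> indX; rewrite residues_preimage measure_preimage_fin //.
have Pf f : P (residues @^-1` [set f]) = ((m.+1 ^ #|I|)%:R^-1)%:E.
  rewrite residuesE (indX _ (fun i => [set x | zres x m = f i])); last first.
    by move=> i; exact: measurable_zres.
  rewrite (eq_bigr (fun=> (m.+1%:R^-1)%:E)); last first.
    by move=> i _; apply: haar_zres; rewrite // -ltnS.
  by rewrite prodEFin prodr_const cardsT natrX exprVn.
rewrite (eq_bigr _ (fun f _ => Pf f)) sumEFin sumr_const.
by rewrite /residue_density [in RHS]mulr_natl.
Qed.

End Residues.

End Probability.

(** * The probability of surjectivity for fixed n *)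

Section SurjectionProbability.
Context {R : realType} {d : measure_display} {Omega : measurableType d}.
Context (P : probability Omega R) (n u : nat)
  (A : 'I_n -> 'I_(n + u) -> Omega -> ZhatM)
  (haarA : forall i j, haar_distributed P (A i j))
  (indA : mutually_independent P (fun ij => A ij.1 ij.2)).

Let free_below N := [set w | all
  (fun p => row_free_mod p (fun ij => zres (A ij.1 ij.2 w) p.-1))
  [seq p <- index_iota 0 N | prime p]].

(** Expressing all conditions through residues modulo one common [q] makes the uniform distribution
    modulo [q] applicable. *)
Let free_belowE N :
  let q := (\prod_(p <- [seq p <- index_iota 0 N | prime p]) p)%N in
  (0 < q)%N /\
  free_below N = [set w | all
    (fun p => row_free_mod p (fun ij => zres (A ij.1 ij.2 w) q.-1))
    [seq p <- index_iota 0 N | prime p]].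
Proof.
move=> q; have q0 : (0 < q)%N.
  by rewrite /q big_filter prodn_cond_gt0 // => p /prime_gt0.
split=> //; apply/funext => w; congr is_true.
apply: eq_in_all => p pr; have pp : prime p by move: pr; rewrite mem_filter => /andP[].
apply: row_free_mod_eq => // ij; have p0 := prime_gt0 pp.
rewrite -[in LHS](@zres_mod _ q.-1 p.-1) prednK // ?modn_mod // prednK //.
by rewrite /q (bigD1_seq p) ?filter_uniq ?iota_uniq //= dvdn_mulr.
Qed.

Let measurable_free_below N : measurable (free_below N).
Proof.
have [q0 ->] := free_belowE N.
exact: (@measurable_residues R d Omega P ('I_n * 'I_(n + u))%type
  (fun ij => A ij.1 ij.2) _ (fun ij => haarA ij.1 ij.2)
  (fun f => all (fun p => row_free_mod p f) [seq p <- index_iota 0 N | prime p])).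
Qed.

Let prob_free_below N :
  P (free_below N) = (\prod_(u.+1 <= k < (n + u).+1) euler_prod k N)%:E.
Proof.
have [q0 ->] := free_belowE N.
rewrite (@prob_residues R d Omega P _ (fun ij => A ij.1 ij.2) _ (fun ij => haarA ij.1 ij.2)
  (fun f => all (fun p => row_free_mod p f) [seq p <- index_iota 0 N | prime p]) indA) prednK //.
rewrite residue_density_primes ?filter_all ?filter_uniq ?iota_uniq //.
(* Interchanging the products over p and k leaves one partial Euler product for each k. *)
rewrite exchange_big /=; congr (_%:E); apply: eq_bigr => k _.
by rewrite euler_prodE.
Qed.

Let surjE : [set w | zhat_mx_surjective (fun i j => A i j w)] = \bigcap_N free_below N.
Proof.
apply/seteqP; split=> w /=.
  move=> /zhat_mx_surjectiveP Aw N _; apply/allP => p; rewrite mem_filter => /andP[pp _].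
  exact: Aw.
move=> Aw; apply/zhat_mx_surjectiveP => p pp.
have /allP := Aw p.+1 I; apply.
by rewrite mem_filter pp mem_index_iota /=.
Qed.

(** The events [free_below N] decrease to surjectivity, so continuity of the measure from above
    applies. *)
Lemma cvg_prob_surjective :
  (fun N => \prod_(u.+1 <= k < (n + u).+1) euler_prod k N) @ \oo -->
  fine (P [set w | zhat_mx_surjective (fun i j => A i j w)]).
Proof.
rewrite surjE.
have c : P \o free_below @ \oo --> P (\bigcap_N free_below N).
  apply: nonincreasing_cvg_mu => //.
  - by rewrite -ge0_fin_numE // fin_num_measure.
  - exact: bigcap_measurable.
  - move=> M N MN; apply/subsetPset => w /allP wN; apply/allP => p.
    rewrite mem_filter mem_index_iota => /andP[pp pM]; apply: wN.
    by rewrite mem_filter mem_index_iota pp (leq_trans pM).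
have f : P (\bigcap_N free_below N) \is a fin_num.
  by rewrite fin_num_measure //; exact: bigcap_measurable.
rewrite -(fineK f) in c; have fc := fine_cvg c.
have -> : (fun N => \prod_(u.+1 <= k < (n + u).+1) euler_prod k N) =
    fine \o (P \o free_below) by apply/funext => N /=; rewrite prob_free_below.
exact: fc.
Qed.

End SurjectionProbability.

(** * The limit as n tends to infinity *)

Lemma cvg_prod_seq (R : realType) (r : seq nat) (f : nat -> nat -> R) (l : nat -> R) :
  (forall k, k \in r -> f k @ \oo --> l k) ->
  (fun N => \prod_(k <- r) f k N) @ \oo --> \prod_(k <- r) l k.
Proof.
elim: r => [|k r IHr] fl.
  by under eq_fun do rewrite big_nil; rewrite big_nil; exact: cvg_cst.
under eq_fun do rewrite big_cons; rewrite big_cons.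
apply: cvgM; first by apply: fl; rewrite mem_head.
by apply: IHr => i ir; apply: fl; rewrite in_cons ir orbT.
Qed.

Unset Implicit Arguments.

Theorem theorem6 (R : realType) (u : nat)
  (d : nat -> measure_display) (Omega : forall n, measurableType (d n))
  (P : forall n, probability (Omega n) R)
  (A : forall n, 'I_n -> 'I_(n + u) -> Omega n -> ZhatM)
  (Haar : forall n i j, haar_distributed (P n) (A n i j))
  (Indep : forall n, mutually_independent (P n)
             (fun ij : 'I_n * 'I_(n + u) => A n ij.1 ij.2)) :
  let prob_surj := fun n : nat =>
    fine (P n [set w | zhat_mx_surjective (fun i j => A n i j w)]) in
  ((0 < u)%N ->
    exists L : R,
      (fun N : nat => \prod_(u.+1 <= k < N) (zeta k)^-1) @ \oo --> L /\
      prob_surj @ \oo --> L)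
  /\
  (u = 0%N -> prob_surj @ \oo --> 0).
Proof.
move=> prob_surj.
have c n := cvg_prob_surjective (Haar n) (Indep n).
split=> [u0|u0].
  (* As [u > 0], every exponent satisfies k >= 2, and the formula is exact for each n. *)
  have probE n : prob_surj n = \prod_(u.+1 <= k < (n + u).+1) (zeta k)^-1.
    apply: (cvg_unique (@Rhausdorff R) (c n)); apply: cvg_prod_seq => k.
    by rewrite mem_index_iota => /andP[uk _]; apply: cvg_euler_prod; lia.
  pose z N : R := \prod_(u.+1 <= k < (N + u).+1) (zeta k)^-1.
  have z_ge0 N : 0 <= z N by rewrite /z -probE fine_ge0.
  (* The products decrease since zeta(k) >= 1 and are bounded below by 0; their limit serves as
     [L]. *)
  have cz : cvgn z.
    apply: nonincreasing_is_cvgn.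
      apply/nonincreasing_seqP => N; rewrite /z addSn big_nat_recr /=; last by lia.
      rewrite ler_piMr //.
        exact: z_ge0.
      by rewrite invf_le1 ?(lt_le_trans ltr01) ?zeta_ge1 //; lia.
    by exists 0 => _ [N _ <-].
  exists (limn z); split; last by rewrite (_ : prob_surj = z) //; apply/funext.
  (* The product over k < N equals [z n] at N = n + u + 1. *)
  rewrite -(cvg_shiftn u.+1).
  by under eq_fun do rewrite addnS.
(* For n = 0 the product is empty and the probability is 1; from n = 1 on the factor k = 1 occurs
   and the probability is exactly 0. *)
rewrite -cvg_shiftS; apply: cvg_near_cst; apply: nearW => n.
subst u; apply: (cvg_unique (@Rhausdorff R) (c n.+1)).
apply: (@squeeze_cvgr _ _ _ _ (cst 0) (euler_prod 1)); first 1 last.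
- exact: cvg_cst.
- exact: cvg_euler_prod1.
apply: nearW => N; apply/andP; split.
  by apply: prodr_ge0 => k _; apply: prodr_ge0 => p; exact: euler_factor_ge0.
(* The factor k = 1 is isolated; the others lie between 0 and 1. *)
rewrite big_ltn // ler_piMr //.
  by apply: prodr_ge0 => p; exact: euler_factor_ge0.
apply: prodr_ile1 => k _; apply/andP; split.
  by apply: prodr_ge0 => p; exact: euler_factor_ge0.
apply: prodr_ile1 => p pp.
by rewrite euler_factor_ge0 //= gerBl invr_ge0 exprn_ge0.
Qed.
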